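(* Let $\mathcal{A}=\{A_1,A_2\}$ be a set of two real $n\times n$ matrices, and consider the switched linear system $x_{k+1}=A_{\sigma(k)}x_k$ (with arbitrary switching $\sigma:\mathbb{Z}\to\{1,2\}$) or the linear difference inclusion $x_{k+1}\in \mathrm{co}(\mathcal{A})\,x_k$. If there exists a symmetric positive definite matrix $P$ such that $$\gamma^2A_1^TPA_1\preceq P,\qquad \gamma^4(A_2A_1)^TP(A_2A_1)\preceq P,$$ $$\gamma^6(A_2^2A_1)^TP(A_2^2A_1)\preceq P,\qquad \gamma^6(A_2^3)^TPA_2^3\preceq P$$ for some $\gamma>1$, then the system is absolutely asymptotically stable, i.e., $\rho(\mathcal{A})<1$.
   Context: The joint spectral radius is $\rho(\mathcal{A})=\lim_{k\to\infty}\max_{\sigma\in\{1,2\}^k}\|A_{\sigma_k}\cdots A_{\sigma_1}\|^{1/k}$. $\mathrm{co}(\mathcal{A})$ is the convex hull of $\mathcal{A}$. Absolute asymptotic stability means global asymptotic stability (of the origin) for all switching sequences (respectively, for all selections in the difference inclusion); it is equivalent, for both systems, to $\rho(\mathcal{A})<1$. $P\preceq Q$ means $Q-P$ is positive semidefinite. *)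

(* Defs.v *)
From HB Require Import structures.
From mathcomp Require Import all_boot all_order all_algebra.
From mathcomp Require Import all_classical all_reals all_analysis.

Set Implicit Arguments.
Unset Strict Implicit.
Unset Printing Implicit Defensive.

Import Order.TTheory GRing.Theory Num.Theory.
Import numFieldNormedType.Exports.

Local Open Scope classical_set_scope.
Local Open Scope ring_scope.

Section Matrices.
Context {R : realType} {n : nat}.
Implicit Types P Q : 'M[R]_n.

Definition posdefmx P : Prop :=
  P^T = P /\ forall x : 'cV[R]_n, x != 0 -> 0 < (x^T *m P *m x) 0 0.

Definition psdmx P : Prop :=
  P^T = P /\ forall x : 'cV[R]_n, 0 <= (x^T *m P *m x) 0 0.

Definition loewner_le P Q : Prop := psdmx (Q - P).

End Matrices.

Section JointSpectralRadius.
Context {R : realType} {n m : nat}.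
Implicit Type A : 'I_m -> 'M[R]_n.

(* For s = [:: s1; ...; sk] this is A_sk *m ... *m A_s1: the letter s1 acts
   first. *)
Definition word_prod A (s : seq 'I_m) : 'M[R]_n :=
  foldl (fun M i => A i *m M) 1%:M s.

(* The norm is the entrywise maximum norm of the library. The limit does not
   depend on the choice of the norm, since all norms on 'M[R]_n are
   equivalent. The neutral element 0 does not affect the maximum because all
   the terms are nonnegative. *)
Definition jsr_seq A (k : nat) : R :=
  \big[Num.max/0]_(s : k.-tuple 'I_m) (`|word_prod A s| `^ k%:R^-1).

Definition jsr A : R := limn (jsr_seq A).

Definition convex_hull A : set 'M[R]_n :=
  [set M | exists w : 'I_m -> R,
    [/\ forall i, 0 <= w i, \sum_i w i = 1 & M = \sum_i w i *: A i]].

End JointSpectralRadius.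

Section Stability.
Context {R : realType} {n : nat}.

Definition trajectory (f : nat -> 'cV[R]_n -> 'cV[R]_n) (x : nat -> 'cV[R]_n) :
  Prop := forall k, x k.+1 = f k (x k).

(* Global asymptotic stability of the origin for x_{k+1} = f_k(x_k):
   Lyapunov stability and global attractivity. *)
Definition globally_asymptotically_stable
    (f : nat -> 'cV[R]_n -> 'cV[R]_n) : Prop :=
  (forall e : R, 0 < e -> exists2 d : R, 0 < d &
     forall x, trajectory f x -> `|x 0%N| < d -> forall k, `|x k| < e) /\
  (forall x, trajectory f x -> x @ \oo --> (0 : 'cV[R]_n)).

Definition switched_aas m (A : 'I_m -> 'M[R]_n) : Prop :=
  forall sigma : int -> 'I_m,
    globally_asymptotically_stable (fun k x => A (sigma k%:Z) *m x).

(* Selections of (k, x) |-> co(A) x may depend on both time and state, so that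
   every solution of the inclusion is a trajectory of some selection. *)
Definition inclusion_aas m (A : 'I_m -> 'M[R]_n) : Prop :=
  forall f : nat -> 'cV[R]_n -> 'cV[R]_n,
    (forall k x, exists2 M, convex_hull A M & f k x = M *m x) ->
    globally_asymptotically_stable f.

End Stability.

(* Main.v *)
Require Import Defs.
From HB Require Import structures.
From mathcomp Require Import all_boot all_order all_algebra.
From mathcomp Require Import all_classical all_reals all_analysis.
From mathcomp Require Import ring lra.

(** The four matrix inequalities say that, for the quadratic form
    [Q x = x^T P x], each of the words 1, 12, 122 and 222 (read in time, the
    first letter acting first) of length [l] shrinks [Q] by [gamma ^- (2 * l)].
    They assemble into a single Lyapunov function: put
      [W x = max (Q x, gamma^2 Q (A2 x), gamma^4 Q (A2^2 x))].
    Applying [A1] to [x] produces three terms controlled by the words 1, 12 and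
    122; applying [A2] turns the first two terms into the last two terms of
    [W x], and the third one is controlled by the word 222. Hence
    [gamma^2 W (A_i x) <= W x] for both matrices ([path_lyapunov_contract]).

    A maximum of convex quadratic forms has convex sublevel sets, so the same
    contraction holds for every matrix of the convex hull
    ([path_lyapunov_quasiconvex]); and [W] is equivalent to the squared norm
    because [P] is positive definite. Every trajectory of the inclusion
    therefore satisfies [|x_N| <= K gamma^-N |x_0|]
    ([lyapunov_hull_exp_bound]), which gives global asymptotic stability of the
    inclusion and, since the matrices [A_i] belong to the hull, of the switched
    system.

    The same estimate applied to basis vectors bounds all products of length
    [k] by [K gamma^-k]; taking [k]-th roots, the joint spectral radius is at
    most [gamma^-1 < 1] ([jsr_le]). The limit that defines it exists by Fekete's
    lemma, applied to the largest norm of a product of length [k], which is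
    submultiplicative up to a constant ([cvgn_jsr_seq]). *)

Set Implicit Arguments.
Unset Strict Implicit.
Unset Printing Implicit Defensive.

Import Order.TTheory GRing.Theory Num.Theory.
Import numFieldNormedType.Exports.

Local Open Scope classical_set_scope.
Local Open Scope ring_scope.

(** * The entrywise maximum norm *)

Section EntrywiseNorm.
Context {R : realType}.

Lemma ler_entry_norm m n (M : 'M[R]_(m, n)) i j : `|M i j| <= `|M|.
Proof.
rewrite [leRHS]/Num.Def.normr/= mx_normrE.
exact: (le_bigmax _ (fun ij : 'I_m * 'I_n => `|M ij.1 ij.2|) (i, j)).
Qed.

Lemma mx_norm_le m n (M : 'M[R]_(m, n)) (a : R) :
  0 <= a -> (forall i j, `|M i j| <= a) -> `|M| <= a.
Proof.
move=> a0 le_Ma; rewrite [leLHS]/Num.Def.normr/= mx_normrE.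
by apply: bigmax_le => // -[i j] _; exact: le_Ma.
Qed.

Lemma normM_le m n p (M : 'M[R]_(m, n)) (N : 'M[R]_(n, p)) :
  `|M *m N| <= n%:R * `|M| * `|N|.
Proof.
apply: mx_norm_le => [|i j]; first by rewrite !mulr_ge0.
rewrite mxE (le_trans (ler_norm_sum _ _ _))//.
rewrite -mulrA mulr_natl -[n in _ *+ n]card_ord -sumr_const ler_sum// => k _.
by rewrite normrM ler_pM// ler_entry_norm.
Qed.

End EntrywiseNorm.

(** * Quadratic forms *)

Section QuadraticForms.
Context {R : realType} {n : nat}.
Implicit Types (P B : 'M[R]_n) (x y z : 'cV[R]_n).

Definition bform P x y : R := (x^T *m P *m y) 0 0.
Definition qform P x : R := bform P x x.

Lemma bform_sumr P x m (w : 'I_m -> R) (y : 'I_m -> 'cV[R]_n) :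
  bform P x (\sum_i w i *: y i) = \sum_i w i * bform P x (y i).
Proof.
rewrite /bform mulmx_sumr summxE; apply: eq_bigr => i _.
by rewrite -scalemxAr mxE.
Qed.

Lemma bformC P x y : P^T = P -> bform P x y = bform P y x.
Proof.
move=> symP; rewrite /bform.
have -> : x^T *m P *m y = (y^T *m P *m x)^T.
  by rewrite !trmx_mul trmxK symP mulmxA.
by rewrite mxE.
Qed.

Lemma qform_lincomb P a b x y : P^T = P ->
  qform P (a *: x - b *: y) =
    a ^+ 2 * qform P x - (2 * a * b) * bform P x y + b ^+ 2 * qform P y.
Proof.
move=> symP; have := bformC y x symP; rewrite /qform /bform => symb.
rewrite [(_ - _)^T]linearB/= ![(_ *: _)^T]linearZ/=.
rewrite !(mulmxBl, mulmxBr) -!(scalemxAl, scalemxAr).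
by rewrite !mxE in symb *; rewrite symb; ring.
Qed.

Lemma qformM P B x : qform P (B *m x) = qform (B^T *m P *m B) x.
Proof. by rewrite /qform /bform trmx_mul !mulmxA. Qed.

Lemma loewner_leP (a : R) P B x :
  loewner_le (a *: (B^T *m P *m B)) P -> a * qform P (B *m x) <= qform P x.
Proof.
case=> _ /(_ x); rewrite qformM /qform /bform mulmxBr mulmxBl.
by rewrite -scalemxAr -scalemxAl !mxE subr_ge0.
Qed.

Lemma posdefmx_psd P : posdefmx P -> psdmx P.
Proof.
case=> symP posP; split=> // x.
have [->|x0] := eqVneq x 0; first by rewrite mulmx0 mxE.
exact/ltW/posP.
Qed.

Lemma qform_ge0 P x : psdmx P -> 0 <= qform P x.
Proof. by case=> _; exact. Qed.

(** Expanding [qform P (z - y i) >= 0] gives the tangent inequality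
    [2 * bform P z (y i) - qform P z <= qform P (y i)]; averaging it at the
    barycentre [z] is Jensen's inequality. *)
Lemma qform_jensen P m (w : 'I_m -> R) (y : 'I_m -> 'cV[R]_n) :
  psdmx P -> (forall i, 0 <= w i) -> \sum_i w i = 1 ->
  qform P (\sum_i w i *: y i) <= \sum_i w i * qform P (y i).
Proof.
move=> psdP w0 w1; set z := \sum_i _.
have tangent i : 2 * bform P z (y i) - qform P z <= qform P (y i).
  have := qform_ge0 (1 *: z - 1 *: y i) psdP.
  by rewrite qform_lincomb ?(proj1 psdP)// expr1n !mul1r !mulr1; lra.
apply: (@le_trans _ _ (\sum_i w i * (2 * bform P z (y i) - qform P z))).
  rewrite [leRHS](_ : _ = 2 * (\sum_i w i * bform P z (y i))
                          - (\sum_i w i) * qform P z).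
    by rewrite -bform_sumr w1 -/(qform P z); lra.
  rewrite mulr_sumr mulr_suml -sumrB; apply: eq_bigr => i _; ring.
by apply: ler_sum => i _; rewrite ler_wpM2l.
Qed.

Lemma bform_cauchy_schwarz P x y : posdefmx P ->
  bform P x y ^+ 2 <= qform P x * qform P y.
Proof.
move=> posP; have [->|y0] := eqVneq y 0.
  by rewrite /qform /bform !mulmx0 !mxE expr0n mulr0.
have qy : 0 < qform P y by case: posP => _; exact.
(* This vector is the component of x orthogonal to y, scaled by qform P y. *)
have := qform_ge0 (qform P y *: x - bform P x y *: y) (posdefmx_psd posP).
rewrite qform_lincomb ?(proj1 posP)// => h.
rewrite -subr_ge0 -(pmulr_rge0 _ qy); apply: le_trans h _.
by rewrite le_eqVlt; apply/orP; left; apply/eqP; ring.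
Qed.

Lemma posdefmx_unit P : posdefmx P -> P \in unitmx.
Proof.
move=> [symP posP]; rewrite -row_free_unit; apply: inj_row_free => v vP0.
apply/eqP; rewrite -[_ == _]negbK; apply/negP => v0.
have := posP v^T; rewrite trmx_eq0 trmxK vP0 mul0mx mxE ltxx.
by move/(_ v0).
Qed.

(** Since [x i = bform P x (P^-1 e_i)], Cauchy-Schwarz bounds every
    coordinate of [x] by a multiple of the square root of [qform P x]. This
    gives an explicit constant without compactness of the unit sphere. *)
Lemma norm2_le_qform P : posdefmx P ->
  exists2 C : R, 0 <= C & forall x, `|x| ^+ 2 <= C * qform P x.
Proof.
move=> posP; have psdP := posdefmx_psd posP.
pose z i := invmx P *m delta_mx i (0 : 'I_1).
exists (\sum_i qform P (z i)) => [|x].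
  by apply: sumr_ge0 => i _; exact: qform_ge0.
have C0 : 0 <= (\sum_i qform P (z i)) * qform P x.
  by rewrite mulr_ge0 ?sumr_ge0// => *; exact: qform_ge0.
rewrite -[leRHS]sqr_sqrtr// ler_sqr ?nnegrE ?sqrtr_ge0//.
apply: mx_norm_le => [|i j]; first exact: sqrtr_ge0.
rewrite -ler_sqr ?nnegrE ?sqrtr_ge0// sqr_sqrtr// real_normK ?num_real//.
have -> : x i j = bform P x (z i).
  rewrite ord1 /bform /z -mulmxA mulKVmx ?posdefmx_unit//.
  by rewrite -colE !mxE.
rewrite (le_trans (bform_cauchy_schwarz _ _ posP))// mulrC.
rewrite ler_wpM2r ?qform_ge0//.
by rewrite (bigD1 i)//= lerDl sumr_ge0// => *; exact: qform_ge0.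
Qed.

Lemma qform_le_norm2 P :
  exists2 D : R, 0 <= D & forall x, qform P x <= D * `|x| ^+ 2.
Proof.
exists (n%:R * n%:R * `|P|) => [|x]; first by rewrite !mulr_ge0.
apply: le_trans (ler_norm _) _; apply: le_trans (ler_entry_norm _ _ _) _.
apply: le_trans (normM_le _ _) _.
rewrite (_ : _ * `|x| ^+ 2 = n%:R * (n%:R * `|x| * `|P|) * `|x|); last by ring.
rewrite ler_wpM2r// ler_wpM2l// (le_trans (normM_le _ _))//.
rewrite ler_wpM2r// ler_wpM2l//; apply: mx_norm_le => // i j.
by rewrite mxE ler_entry_norm.
Qed.

End QuadraticForms.

(** * A common Lyapunov function *)

Section Lyapunov.
Context {R : realType} {n : nat}.
Implicit Types (P B : 'M[R]_n) (x : 'cV[R]_n) (g : R).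

(** With [Q = qform P], one cannot compare [Q (B *m x)] or
    [Q (B *m B *m x)] to [Q x] in one step, so the maximum also records what
    [Q] becomes after one or two further applications of [B], discounted at
    the rate that is to be proved. *)
Definition path_lyapunov P B g x : R :=
  Num.max (qform P x)
    (Num.max (g ^+ 2 * qform P (B *m x)) (g ^+ 4 * qform P (B *m (B *m x)))).

(** At [A1 x] the three terms, multiplied by [g ^+ 2], are the left-hand sides
    of the first three inequalities, hence at most [Q x]. At [A2 x] the first
    two become the last two terms at [x], and the third one is the left-hand
    side of the last inequality, again at most [Q x]. *)
Lemma path_lyapunov_contract P A1 A2 g x : 0 <= g ->
  loewner_le (g ^+ 2 *: (A1^T *m P *m A1)) P ->
  loewner_le (g ^+ 4 *: ((A2 *m A1)^T *m P *m (A2 *m A1))) P ->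
  loewner_le (g ^+ 6 *: ((A2 ^+ 2 *m A1)^T *m P *m (A2 ^+ 2 *m A1))) P ->
  loewner_le (g ^+ 6 *: ((A2 ^+ 3)^T *m P *m A2 ^+ 3)) P ->
  forall i, g ^+ 2 * path_lyapunov P A2 g (tnth [tuple A1; A2] i *m x) <=
            path_lyapunov P A2 g x.
Proof.
move=> g0 h1 h2 h3 h4 i; have g20 : 0 <= g ^+ 2 by rewrite exprn_ge0.
rewrite /path_lyapunov !maxr_pMr// ![g ^+ 2 * (g ^+ _ * _)]mulrA -!exprD.
rewrite !ge_max !le_max.
have := loewner_leP x h1; have := loewner_leP x h2.
have := loewner_leP x h3; have := loewner_leP x h4.
rewrite (_ : A2 ^+ 3 = A2 *m (A2 *m A2)); last by rewrite !exprS expr0 mulr1.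
rewrite (_ : A2 ^+ 2 = A2 *m A2); last by rewrite !exprS expr0 mulr1.
case: i => -[|[|//]] ltk; rewrite (tnth_nth 0)/= -!mulmxA => l4 l3 l2 l1;
  by rewrite ?l1 ?l2 ?l3 ?l4 ?lexx ?orbT.
Qed.

(** Sublevel sets of a maximum of convex functions are convex. This is what
    passes the contraction from the two matrices to their convex hull. *)
Lemma path_lyapunov_quasiconvex P B g m (w : 'I_m -> R) (y : 'I_m -> 'cV[R]_n)
    a :
  psdmx P -> (forall i, 0 <= w i) -> \sum_i w i = 1 ->
  (forall i, path_lyapunov P B g (y i) <= a) ->
  path_lyapunov P B g (\sum_i w i *: y i) <= a.
Proof.
move=> psdP w0 w1 ya.
have sublevel (z : 'I_m -> 'cV[R]_n) c : 0 <= c ->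
    (forall i, c * qform P (z i) <= a) ->
    c * qform P (\sum_i w i *: z i) <= a.
  move=> c0 za; apply: (@le_trans _ _ (c * \sum_i w i * qform P (z i))).
    by rewrite ler_wpM2l// qform_jensen.
  rewrite mulr_sumr -[leRHS]mul1r -w1 mulr_suml; apply: ler_sum => i _.
  by rewrite mulrCA ler_wpM2l.
have mulB (z : 'I_m -> 'cV[R]_n) :
    B *m (\sum_i w i *: z i) = \sum_i w i *: (B *m z i).
  by rewrite mulmx_sumr; apply: eq_bigr => i _; rewrite -scalemxAr.
rewrite /path_lyapunov !mulB !ge_max -[X in (X <= a) && _]mul1r.
apply/and3P; split; apply: sublevel => [|i]; rewrite ?exprn_even_ge0//.
- by have := ya i; rewrite !ge_max mul1r => /and3P[].
- by have := ya i; rewrite !ge_max => /and3P[].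
- by have := ya i; rewrite !ge_max => /and3P[].
Qed.

Lemma norm2_le_path_lyapunov P B g : posdefmx P ->
  exists2 C : R, 0 <= C & forall x, `|x| ^+ 2 <= C * path_lyapunov P B g x.
Proof.
move=> /norm2_le_qform[C C0 leC]; exists C => // x.
by rewrite (le_trans (leC x))// ler_wpM2l// le_max lexx.
Qed.

Lemma path_lyapunov_le_norm2 P B g :
  exists2 D : R, 0 <= D & forall x, path_lyapunov P B g x <= D * `|x| ^+ 2.
Proof.
have [D0 D00 leD0] := qform_le_norm2 P.
have [D1 D10 leD1] := qform_le_norm2 (B^T *m P *m B).
have [D2 D20 leD2] := qform_le_norm2 ((B *m B)^T *m P *m (B *m B)).
have g2 : 0 <= g ^+ 2 by rewrite exprn_even_ge0.
have g4 : 0 <= g ^+ 4 by rewrite exprn_even_ge0.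
exists (D0 + (g ^+ 2 * D1 + g ^+ 4 * D2)) => [|x].
  by rewrite !addr_ge0// mulr_ge0.
rewrite /path_lyapunov !ge_max mulmxA !(@qformM _ _ P); apply/and3P; split.
- by rewrite (le_trans (leD0 x))// ler_wpM2r// lerDl addr_ge0// mulr_ge0.
- rewrite (le_trans (ler_wpM2l g2 (leD1 x)))// mulrA ler_wpM2r//.
  by rewrite addrCA lerDl addr_ge0// mulr_ge0.
- rewrite (le_trans (ler_wpM2l g4 (leD2 x)))// mulrA ler_wpM2r//.
  by rewrite addrA lerDr addr_ge0// mulr_ge0.
Qed.

End Lyapunov.

(** * Exponential bounds along trajectories *)

Section ExponentialBound.
Context {R : realType} {n m : nat}.
Implicit Types (A : 'I_m -> 'M[R]_n) (x : nat -> 'cV[R]_n) (K r : R).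

(** The horizon [N] is finite so that the bound covers both infinite
    trajectories and finite products of matrices. *)
Definition hull_exp_bound A K r : Prop :=
  forall x N,
    (forall k, (k < N)%N -> exists2 M, convex_hull A M & x k.+1 = M *m x k) ->
    `|x N| <= K * r ^+ N * `|x 0%N|.

(** [V] plays the role of a squared norm, hence the contraction factor
    [r ^+ 2]; the direct estimate is
    [`|x N| ^+ 2 <= C * D * (r ^+ N * `|x 0|) ^+ 2], and [1 + C * D] is a
    square-root-free bound for the square root of [C * D]. *)
Lemma lyapunov_hull_exp_bound A (V : 'cV[R]_n -> R) (C D r : R) :
  0 <= r -> 0 <= C -> 0 <= D ->
  (forall i y, V (A i *m y) <= r ^+ 2 * V y) ->
  (forall (w : 'I_m -> R) (y : 'I_m -> 'cV[R]_n) a,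
     (forall i, 0 <= w i) -> \sum_i w i = 1 -> (forall i, V (y i) <= a) ->
     V (\sum_i w i *: y i) <= a) ->
  (forall y, `|y| ^+ 2 <= C * V y) -> (forall y, V y <= D * `|y| ^+ 2) ->
  hull_exp_bound A (1 + C * D) r.
Proof.
move=> r0 C0 D0 contractV qconvV leC leD x N hx.
have VN : V (x N) <= (r ^+ N) ^+ 2 * V (x 0%N).
  elim: N hx => [_|N IH hx]; first by rewrite expr0 expr1n mul1r.
  have [M [w [w0 w1 ->]] ->] := hx N (leqnn _).
  have -> : (\sum_i w i *: A i) *m x N = \sum_i w i *: (A i *m x N).
    by rewrite mulmx_suml; apply: eq_bigr => i _; rewrite -scalemxAl.
  apply: qconvV => // i; rewrite (le_trans (contractV i _))//.
  rewrite [r ^+ N.+1]exprS exprMn -[leRHS]mulrA.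
  rewrite ler_wpM2l ?exprn_ge0// IH// => k kN.
  by apply: hx; rewrite ltnS ltnW.
have rN : 0 <= r ^+ N by rewrite exprn_ge0.
have CD : 0 <= C * D by rewrite mulr_ge0.
rewrite -ler_sqr ?nnegrE ?mulr_ge0 ?addr_ge0//.
rewrite (le_trans (leC _))// (le_trans (ler_wpM2l C0 VN))//.
rewrite (le_trans (ler_wpM2l C0 (ler_wpM2l _ (leD _))))// ?exprn_ge0//.
rewrite [leLHS](_ : _ = C * D * ((r ^+ N) ^+ 2 * `|x 0%N| ^+ 2)); last by ring.
rewrite !exprMn -[leRHS]mulrA ler_wpM2r ?mulr_ge0 ?exprn_ge0//; nra.
Qed.

Lemma convex_hull_vertex A i : convex_hull A (A i).
Proof.
exists (fun j => (j == i)%:R); split => [j||].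
- by rewrite ler0n.
- by rewrite (bigD1 i)//= eqxx big1 ?addr0// => j /negPf ->.
- rewrite (bigD1 i)//= eqxx scale1r big1 ?addr0// => j /negPf ->.
  by rewrite scale0r.
Qed.

Lemma hull_exp_bound_gas A K r (f : nat -> 'cV[R]_n -> 'cV[R]_n) :
  0 < K -> 0 <= r < 1 -> hull_exp_bound A K r ->
  (forall k y, exists2 M, convex_hull A M & f k y = M *m y) ->
  globally_asymptotically_stable f.
Proof.
move=> K0 /andP[r0 r1] bndA hf.
have bnd x k : trajectory f x -> `|x k| <= K * r ^+ k * `|x 0%N|.
  move=> trx; apply: bndA => j _; have [M hM fE] := hf j (x j).
  by exists M => //; rewrite trx.
split=> [e e0|x trx].
  exists (e / K) => [|x trx]; first by rewrite divr_gt0.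
  rewrite ltr_pdivlMr// => x0 k; apply: le_lt_trans (bnd _ _ trx) _.
  rewrite (le_lt_trans _ x0)// mulrC ler_wpM2l// ger_pMr// exprn_ile1//.
  exact: ltW.
apply/cvgr0Pnorm_le => e e0.
have : (fun k => r ^+ k * (K * `|x 0%N|)) @ \oo --> 0 * (K * `|x 0%N|).
  by apply: cvgMl; apply: cvg_expr; rewrite ger0_norm.
rewrite mul0r => /cvgr0Pnorm_le/(_ _ e0); apply: filterS => k.
rewrite ger0_norm ?mulr_ge0 ?exprn_ge0 ?(ltW K0)// => /(le_trans _); apply.
by rewrite (le_trans (bnd _ _ trx))// mulrCA mulrA.
Qed.

Lemma word_prod_rcons A s i : word_prod A (rcons s i) = A i *m word_prod A s.
Proof. by rewrite /word_prod foldl_rcons. Qed.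

Lemma word_prod_cat A s t :
  word_prod A (s ++ t) = word_prod A t *m word_prod A s.
Proof.
elim/last_ind: t => [|t i IH]; first by rewrite cats0 mul1mx.
by rewrite -rcons_cat !word_prod_rcons IH mulmxA.
Qed.

(** Column [j] of [word_prod A s] is the end point of the trajectory that
    starts at the basis vector [e_j] and follows the letters of [s]. *)
Lemma hull_exp_bound_word A K r s :
  0 <= K -> 0 <= r -> hull_exp_bound A K r ->
  `|word_prod A s| <= K * r ^+ size s.
Proof.
move=> K0 r0 bndA; apply: mx_norm_le => [|i j].
  by rewrite mulr_ge0 ?exprn_ge0.
pose x k := word_prod A (take k s) *m delta_mx j (0 : 'I_1).
have -> : word_prod A s i j = x (size s) i 0.
  by rewrite /x take_size -colE mxE.
rewrite (le_trans (ler_entry_norm _ _ _))//.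
have {}/bndA : forall k, (k < size s)%N ->
    exists2 M, convex_hull A M & x k.+1 = M *m x k.
  case: s @x => [//|i0 s] x k ks; exists (A (nth i0 (i0 :: s) k)).
    exact: convex_hull_vertex.
  by rewrite /x (take_nth i0)// word_prod_rcons mulmxA.
move=> /le_trans; apply; rewrite ler_piMr ?mulr_ge0 ?exprn_ge0//.
rewrite /x take0 mul1mx; apply: mx_norm_le => // k l.
by rewrite mxE; case: (_ && _); rewrite ?normr1 ?normr0.
Qed.

End ExponentialBound.

(** * Fekete's lemma in multiplicative form *)

Section Fekete.
Context {R : realType}.
Implicit Types (b : nat -> R) (c K a : R).

Lemma cvg_root_const K : 0 < K -> (fun k => K `^ k%:R^-1) @ \oo --> (1 : R).
Proof.
move=> K0.
have -> : (fun k : nat => K `^ k%:R^-1) = expR \o (fun k => k%:R^-1 * ln K).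
  by apply/funext => k; rewrite /powR gt_eqF.
have : (fun k : nat => k%:R^-1 * ln K) @ \oo --> 0 * ln K.
  apply: cvgMl; rewrite -cvg_shiftS; exact: cvg_harmonic.
rewrite mul0r => cvg0.
have := continuous_cvg _ (@continuous_expR R 0) cvg0.
by rewrite [X in _ --> X]expR0; exact.
Qed.

Lemma root_exp_bound b K a k : 0 <= b k -> 0 <= K -> 0 <= a -> (0 < k)%N ->
  b k <= K * a ^+ k -> b k `^ k%:R^-1 <= K `^ k%:R^-1 * a.
Proof.
move=> b0 K0 a0 k0 leb.
have -> : K `^ k%:R^-1 * a = (K * a ^+ k) `^ k%:R^-1.
  rewrite powRM ?exprn_ge0// -[a ^+ k]powR_mulrn// -powRrM divff ?powRr1//.
  by rewrite pnatr_eq0 -lt0n.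
by apply: ge0_ler_powR; rewrite ?nnegrE ?invr_ge0 ?mulr_ge0 ?exprn_ge0.
Qed.

Lemma root_expK a k : 0 <= a -> (0 < k)%N -> (a `^ k%:R^-1) ^+ k = a.
Proof.
move=> a0 k0; rewrite -powR_mulrn ?powR_ge0// -powRrM mulVf ?powRr1//.
by rewrite pnatr_eq0 -lt0n.
Qed.

(** Writing [k = q * p + i] with [i < p], submultiplicativity gives
    [b k <= b p ^+ q * b i <= a ^+ k * (b i / a ^+ i)]; the constant sums these
    finitely many quotients, and the [1 +] makes it positive. *)
Lemma submultiplicative_exp_bound b a p : (forall k, 0 <= b k) ->
  (forall j k, b (j + k)%N <= b j * b k) ->
  0 < a -> (0 < p)%N -> b p <= a ^+ p ->
  exists2 K : R, 0 < K & forall k, b k <= K * a ^+ k.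
Proof.
move=> b0 subb a0 p0 bp; pose K := 1 + \sum_(i < p) b i / a ^+ i.
have q0 k : 0 <= b k / a ^+ k by rewrite divr_ge0// exprn_ge0// ltW.
exists K => [|k]; first by rewrite ltr_pwDl// sumr_ge0.
elim/ltn_ind: k => k IH; have [kp|pk] := ltnP k p.
  rewrite -ler_pdivrMr ?exprn_gt0// /K (bigD1 (Ordinal kp))//=.
  by rewrite addrCA lerDl addr_ge0// sumr_ge0.
rewrite -(subnKC pk) exprD mulrCA (le_trans (subb _ _))//.
by rewrite ler_pM// IH// ltn_subrL p0 (leq_trans p0 pk).
Qed.

(** The limit is the infimum of the roots over [k > 0]: a root that is within
    [e / 2] of the infimum governs, through [submultiplicative_exp_bound], all
    later ones up to a factor tending to 1. Working with roots instead of
    logarithms treats vanishing terms uniformly. *)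
Lemma cvgn_root_submultiplicative b : (forall k, 0 <= b k) ->
  (forall j k, b (j + k)%N <= b j * b k) -> cvgn (fun k => b k `^ k%:R^-1).
Proof.
move=> b0 subb; pose E := [set b k `^ k%:R^-1 | k in [set k | (0 < k)%N]].
have lbE : has_lbound E by exists 0 => _ [k _ <-]; exact: powR_ge0.
have infE : has_inf E by split => //; exists (b 1%N `^ 1%:R^-1), 1%N.
have inf0 : 0 <= inf E.
  by apply: lb_le_inf => [|_ [k _ <-]]; [case: infE | exact: powR_ge0].
apply/cvg_ex; exists (inf E); apply/cvgrPdist_lt => e e0.
have e20 : 0 < e / 2 by rewrite divr_gt0.
have [_ [p /= p0 <-] ltp] := inf_adherent e20 infE.
set a := inf E + e / 2 in ltp; have a0 : 0 < a by rewrite ltr_wpDl.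
have [K K0 leK] : exists2 K : R, 0 < K & forall k, b k <= K * a ^+ k.
  apply: submultiplicative_exp_bound (p0) _ => //.
  rewrite -[leLHS](root_expK (b0 p) p0) ler_pXn2r ?nnegrE ?powR_ge0 ?(ltW a0)//.
  exact: ltW.
have : (fun k : nat => K `^ k%:R^-1 * a) @ \oo --> 1 * a.
  by apply: cvgMl; exact: cvg_root_const.
rewrite mul1r => /cvgrPdist_lt/(_ _ e20).
apply: filterS2 (nbhs_infty_gt 0) => k k0.
have := root_exp_bound (b0 k) (ltW K0) (ltW a0) k0 (leK k).
have : inf E <= b k `^ k%:R^-1 by apply: ge_inf => //; exists k.
rewrite /a !ltr_norml => ? ? /andP[? ?]; apply/andP; split; lra.
Qed.

(** [c * b k] is submultiplicative, and the roots of [c] tend to 1. *)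
Lemma cvgn_root_quasi_submultiplicative b c : 0 < c -> (forall k, 0 <= b k) ->
  (forall j k, b (j + k)%N <= c * b j * b k) ->
  cvgn (fun k => b k `^ k%:R^-1).
Proof.
move=> c0 b0 subb.
have cb0 k : 0 <= c * b k by rewrite mulr_ge0 ?(ltW c0).
have -> : (fun k => b k `^ k%:R^-1) =
    (fun k => c^-1 `^ k%:R^-1) * (fun k => (c * b k) `^ k%:R^-1).
  apply/funext => k /=; rewrite -[RHS]powRM ?invr_ge0 ?(ltW c0)//.
  by rewrite mulKf// gt_eqF.
apply: is_cvgM.
  by apply/cvg_ex; exists 1; apply: cvg_root_const; rewrite invr_gt0.
apply: cvgn_root_submultiplicative => // j k.
by rewrite (_ : _ * _ * _ = c * (c * b j * b k)) ?ler_wpM2l ?(ltW c0)//; ring.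
Qed.

End Fekete.

(** * The joint spectral radius *)

Section JointSpectralRadiusFacts.
Context {R : realType} {n m : nat}.
Implicit Types (A : 'I_m -> 'M[R]_n) (K r : R).

Definition max_word_norm A k : R :=
  \big[Num.max/0]_(s : k.-tuple 'I_m) `|word_prod A s|.

Lemma max_word_norm_ge0 A k : 0 <= max_word_norm A k.
Proof. exact: bigmax_ge_id. Qed.

Lemma jsr_seqE A k : (0 < k)%N -> jsr_seq A k = max_word_norm A k `^ k%:R^-1.
Proof.
move=> k0; have kV0 : k%:R^-1 != 0 :> R by rewrite invr_eq0 pnatr_eq0 -lt0n.
suff [-> //] : jsr_seq A k = max_word_norm A k `^ k%:R^-1 /\
  0 <= max_word_norm A k.
rewrite /jsr_seq /max_word_norm.
elim/big_ind2 : _ => [|u ? v ? [-> u0] [-> v0]|s _].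
- by rewrite powR0.
- split; last by rewrite le_max u0.
  have powR_le : {in Num.nneg &, {mono (@powR R)^~ k%:R^-1 : y z / y <= z}}.
    apply: le_mono_in; apply: gt0_ltr_powR.
    by rewrite invr_gt0 ltr0n.
  have [uv|vu] := leP u v.
    by apply: max_r; rewrite powR_le.
  by apply: max_l; rewrite powR_le// ltW.
- by split.
Qed.

(** The factor compensates for the entrywise norm not being submultiplicative;
    [n.+1] rather than [n] keeps it positive when [n = 0]. *)
Lemma max_word_normD A j k :
  max_word_norm A (j + k) <= n.+1%:R * max_word_norm A j * max_word_norm A k.
Proof.
have b0 := max_word_norm_ge0 A.
apply: bigmax_le => [|s _]; first by rewrite !mulr_ge0.
have js : size (take j s) == j by rewrite size_takel// size_tuple leq_addr.
have ks : size (drop j s) == k by rewrite size_drop size_tuple addKn.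
rewrite -[tval s](cat_take_drop j) word_prod_cat (le_trans (normM_le _ _))//.
rewrite mulrAC; apply: ler_pM; rewrite ?mulr_ge0//.
  apply: ler_pM => //; first by rewrite ler_nat.
  exact: (le_bigmax _ (fun t : j.-tuple _ => `|word_prod A t|) (Tuple js)).
exact: (le_bigmax _ (fun t : k.-tuple _ => `|word_prod A t|) (Tuple ks)).
Qed.

Lemma cvgn_jsr_seq A : cvgn (jsr_seq A).
Proof.
have near_eq : \forall k \near \oo, max_word_norm A k `^ k%:R^-1 = jsr_seq A k.
  by apply: filterS (nbhs_infty_gt 0) => k k0; rewrite jsr_seqE.
suff : cvgn (fun k => max_word_norm A k `^ k%:R^-1).
  move=> /cvg_ex[l cvgl]; apply/cvg_ex; exists l.
  by apply: cvg_trans cvgl; exact: near_eq_cvg.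
apply: (@cvgn_root_quasi_submultiplicative _ _ n.+1%:R) => // k.
- exact: max_word_norm_ge0.
- exact: max_word_normD.
Qed.

Lemma jsr_le A K r : 0 < K -> 0 <= r -> hull_exp_bound A K r -> jsr A <= r.
Proof.
move=> K0 r0 bndA; rewrite /jsr.
have cvgKr : (fun k : nat => K `^ k%:R^-1 * r) @ \oo --> 1 * r.
  by apply: cvgMl; exact: cvg_root_const.
rewrite -[r]mul1r; apply: (ler_cvg_to (@cvgn_jsr_seq A) cvgKr).
apply: filterS (nbhs_infty_gt 0) => k k0; rewrite jsr_seqE//.
apply: root_exp_bound; rewrite ?max_word_norm_ge0 ?(ltW K0)//.
apply: bigmax_le => [|s _]; first by rewrite mulr_ge0 ?exprn_ge0 ?(ltW K0).
by rewrite -[k in _ ^+ k](size_tuple s) hull_exp_bound_word ?(ltW K0).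
Qed.

End JointSpectralRadiusFacts.

Theorem proposition3p6 (R : realType) (n : nat) (A1 A2 : 'M[R]_n)
  (hP : exists (P : 'M[R]_n) (gamma : R),
     [/\ posdefmx P, 1 < gamma &
      [/\ loewner_le (gamma ^+ 2 *: (A1^T *m P *m A1)) P,
          loewner_le (gamma ^+ 4 *: ((A2 *m A1)^T *m P *m (A2 *m A1))) P,
          loewner_le
            (gamma ^+ 6 *: ((A2 ^+ 2 *m A1)^T *m P *m (A2 ^+ 2 *m A1))) P &
          loewner_le (gamma ^+ 6 *: ((A2 ^+ 3)^T *m P *m A2 ^+ 3)) P]]) :
  let A := tnth [tuple A1; A2] in
  [/\ switched_aas A, inclusion_aas A, cvgn (jsr_seq A) & jsr A < 1].
Proof.
move: hP => [P [g [posP g1 [h1 h2 h3 h4]]]] A.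
have g0 : 0 < g by rewrite (lt_trans ltr01).
have gV0 : 0 <= g^-1 by rewrite invr_ge0 ltW.
have gV1 : g^-1 < 1 by rewrite invf_lt1.
have [C C0 leC] := norm2_le_path_lyapunov A2 g posP.
have [D D0 leD] := path_lyapunov_le_norm2 P A2 g.
have K0 : 0 < 1 + C * D by rewrite ltr_pwDl// mulr_ge0.
have bndA : hull_exp_bound A (1 + C * D) g^-1.
  apply: lyapunov_hull_exp_bound leC leD => // [i y|w y a w0 w1 ya].
    rewrite exprVn ler_pdivlMl ?exprn_gt0//.
    by apply: path_lyapunov_contract => //; exact: ltW.
  exact: path_lyapunov_quasiconvex (posdefmx_psd posP) w0 w1 ya.
have gV01 : 0 <= g^-1 < 1 by rewrite gV0.
split.
- move=> sigma; apply: (hull_exp_bound_gas K0 gV01 bndA) => k y.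
  by exists (A (sigma k%:Z)) => //; exact: convex_hull_vertex.
- by move=> f hf; exact: (hull_exp_bound_gas K0 gV01 bndA).
- exact: cvgn_jsr_seq.
- exact: le_lt_trans (jsr_le K0 gV0 bndA) gV1.
Qed.
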